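(* Suppose that a function $f\in L^1(\mathbb{T})$ satisfies the condition $$\sum_{|k|\geq n+1}|\widehat{f}(k)|^p=O\left(\frac{1}{n^{p-1}}\right)\quad\text{as } n\to\infty$$ for a certain number $p>1$. Then, for every closed set $K\subset\mathbb{T}$ with $K\subset C_f$, $S_n(x,f)$ converges to $f(x)$ uniformly with respect to $x\in K$ as $n\to\infty$.
   Context: $\mathbb{T}$ is the additive quotient group $\mathbb{R}/2\pi\mathbb{Z}$; functions on $\mathbb{T}$ are identified with $2\pi$-periodic functions. $L^1(\mathbb{T})$ is the space of complex-valued Lebesgue-integrable functions on $\mathbb{T}$; here $f$ is regarded as an actual function defined at every point of $\mathbb{T}$. $C_f$ is the set of all points of $\mathbb{T}$ at which $f:\mathbb{T}\to\mathbb{C}$ is continuous. The Fourier coefficients are $\widehat{f}(k):=\frac{1}{2\pi}\int_{-\pi}^{\pi}f(s)e^{-iks}\,ds$, $k\in\mathbb{Z}$, and $S_n(x,f):=\sum_{|k|\leq n}\widehat{f}(k)e^{ikx}$ for integers $n\geq0$. *)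

(* Defs.v *)
From HB Require Import structures.
From mathcomp Require Import all_boot all_order all_algebra.
From mathcomp Require Import all_classical all_reals all_analysis.
From mathcomp Require Import complex.

Set Implicit Arguments.
Unset Strict Implicit.
Unset Printing Implicit Defensive.

Import Order.TTheory GRing.Theory Num.Theory.
Import numFieldNormedType.Exports.

Local Open Scope classical_set_scope.
Local Open Scope ring_scope.
Local Open Scope complex_scope.

(* Functions on the circle R/2piZ are represented by 2pi-periodic functions
   R -> R[i], and subsets of the circle by their preimages in R, i.e. by the
   subsets of R invariant under translation by 2pi; by definition of the
   quotient topology, a subset of the circle is closed iff its preimage is. *)

Definition periodic_set (R : realType) (K : set R) : Prop :=
  forall x : R, K (x + 2 * pi) <-> K x.

Definition expi (R : realType) (x : R) : R[i] := cos x +i* sin x.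

(* lebesgue_measure lives on the Borel sets; its completion is used so that
   integrands are only required to be Lebesgue-measurable. *)
Definition cintegrable (R : realType) (D : set R) (f : R -> R[i]) : Prop :=
  completed_lebesgue_measure.-integrable D (fun s : R => (complex.Re (f s))%:E) /\
  completed_lebesgue_measure.-integrable D (fun s : R => (complex.Im (f s))%:E).

Definition cintegral (R : realType) (D : set R) (f : R -> R[i]) : R[i] :=
  (\int[completed_lebesgue_measure]_(s in D) complex.Re (f s))%R +i*
  (\int[completed_lebesgue_measure]_(s in D) complex.Im (f s))%R.

Definition L1_circle (R : realType) (f : R -> R[i]) : Prop :=
  periodic f (2 * pi) /\ cintegrable `[- pi, pi] f.

Definition fourier_coef (R : realType) (f : R -> R[i]) (k : int) : R[i] :=
  ((2 * pi)^-1)%:C *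
  cintegral `[- pi, pi] (fun s : R => f s * expi (- (k%:~R * s))).

(* The integers k with |k| <= n are listed as j - n for 0 <= j <= 2n. *)
Definition fourier_sum (R : realType) (f : R -> R[i]) (n : nat) (x : R)
    : R[i] :=
  \sum_(j < n.*2.+1)
    fourier_coef f (j%:Z - n%:Z) * expi ((j%:Z - n%:Z)%:~R * x).

(* Valued in \bar R, so that it is +oo when the series diverges. *)
Definition fourier_tail (R : realType) (f : R -> R[i]) (p : R) (n : nat)
    : \bar R :=
  \esum_(k in [set k : int | (n.+1 <= `|k|)%N])
    (Normc.normc (fourier_coef f k) `^ p)%:E.

(* R[i] carries its usual topology through the alias R[i]^o. *)
Definition continuity_set (R : realType) (f : R -> R[i]) : set R :=
  [set x | {for x, continuous (f : R -> R[i]^o)}].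

(* Main.v *)
(** The Cesaro sums E_m = sum_(j < m) (S_j f - f) satisfy E_m = o(m) uniformly
    on K: writing E_m with the Fejer kernel F_m, which is nonnegative and
    satisfies F_m(t) (1 - cos t) = 1 - cos (m t), the integrand
    |f(s) - f(x)| F_m(x - s) is at most
    eps F_m(x - s) + (2 / eta) (|f(s)| + sup_K |f|), where eta comes from the
    uniform modulus of continuity of f at the points of the compact set K.
    For l of order n / L we have
    l (S_n f - f) = E_(n+l) - E_n - sum_(i < l) (S_(n+i) f - S_n f).
    The first two terms are o(l), and |S_(n+i) f - S_n f| is at most the sum
    of |c_k| over n < |k| <= n + n / L. Since a <= tau + a^p / tau^(p-1), with
    tau = M / n this sum is at most 2 M / L + C / M^(p-1), which is small for M
    large and then L large. *)

Require Import Defs.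
From HB Require Import structures.
From mathcomp Require Import all_boot all_order all_algebra.
From mathcomp Require Import all_classical all_reals all_analysis.
From mathcomp Require Import measurable_realfun complex.
From mathcomp Require Import ring lra zify.

Set Implicit Arguments.
Unset Strict Implicit.
Unset Printing Implicit Defensive.

Import Order.TTheory GRing.Theory Num.Theory.
Import numFieldNormedType.Exports.

Local Open Scope classical_set_scope.
Local Open Scope ring_scope.

Local Open Scope complex_scope.

Local Notation lebesgueR R := (caratheodory_type (((@wlength R idfun)^*)%mu)).
Local Notation mu := completed_lebesgue_measure.
Local Notation Re := complex.Re.
Local Notation Im := complex.Im.
Local Notation normc := Normc.normc.

(** * Integration over one period for the completed Lebesgue measure *)

Lemma measurable_lebesgueR (R : realType) (A : set R) :
  measurable (A : set (measurableTypeR R)) ->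
  measurable (A : set (lebesgueR R)).
Proof. exact: sub_caratheodory. Qed.

(** Carries Borel measurability, hence that of continuous functions, over to the Caratheodory
    sigma-algebra. *)
Lemma measurable_idfun_lebesgueR (R : realType) :
  measurable_fun [set: lebesgueR R] (idfun : lebesgueR R -> measurableTypeR R).
Proof. by move=> _ A mA; rewrite setTI; exact: measurable_lebesgueR. Qed.

Lemma measurable_fun_lebesgueR (R : realType) (D : set R) (g : R -> R) :
  continuous g -> measurable_fun (D : set (lebesgueR R)) g.
Proof.
move=> cg; apply: measurable_funTS.
have mg : measurable_fun [set: measurableTypeR R] g.
  exact: continuous_measurable_fun.
exact: measurableT_comp mg (@measurable_idfun_lebesgueR R).
Qed.

Lemma measurable_circle (R : realType) :
  measurable (`[- pi, pi] : set (lebesgueR R)).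
Proof. by apply: measurable_lebesgueR; exact: measurable_itv. Qed.

Lemma bounded_circle (R : realType) (g : R -> R) : continuous g ->
  [bounded g x | x in (`[- pi, pi] : set R)].
Proof.
move=> cg.
have : compact (g @` `[- pi, pi]).
  by apply: continuous_compact; [exact: continuous_subspaceT|exact: segment_compact].
move/compact_bounded => [M [Mr hM]]; exists M; split => // y My x Dx.
by apply: hM My _ _; exists x.
Qed.

Definition circle_integrable (R : realType) (u : R -> R) :=
  mu.-integrable `[- pi, pi] (EFin \o u).

Definition circle_integral (R : realType) (u : R -> R) : R :=
  (\int[mu]_(s in `[- pi, pi]) u s)%R.

Lemma circle_integrableM (R : realType) (u g : R -> R) :
  circle_integrable u -> continuous g -> circle_integrable (fun s => u s * g s).
Proof.
move=> iu cg; apply: eq_integrable (integrableMl _ iu _ _) => //.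
- exact: measurable_circle.
- exact: measurable_circle.
- exact: measurable_fun_lebesgueR.
- exact: bounded_circle.
Qed.

Lemma mu_circle (R : realType) :
  mu (`[- pi, pi] : set R) = (pi *+ 2)%:E :> \bar R.
Proof.
have -> : mu (`[- pi, pi] : set R) = lebesgue_measure (`[- pi, pi] : set R) by [].
rewrite lebesgue_measure_itv/= lte_fin gtrN ?pi_gt0//= -EFinB.
by rewrite opprK mulr2n.
Qed.

Lemma continuous_circle_integrable (R : realType) (g : R -> R) :
  continuous g -> circle_integrable g.
Proof.
move=> cg; apply: measurable_bounded_integrable.
- exact: measurable_circle.
- have muoo : (mu (`[(- pi)%R, pi%R] : set R) < +oo)%E by rewrite mu_circle ltry.
  exact: muoo.
- exact: measurable_fun_lebesgueR.
- exact: bounded_circle.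
Qed.

(* The completed measure is carried to Lebesgue measure by the identity map. *)
Lemma circle_integralE (R : realType) (g : R -> R) : continuous g ->
  circle_integral g = (\int[lebesgue_measure]_(s in `[- pi, pi]) g s)%R.
Proof.
move=> cg; rewrite /circle_integral /Rintegral; congr fine.
rewrite [RHS](integral_pushforward (@measurable_idfun_lebesgueR R)
  (mu := mu)) //.
- by apply/measurable_EFinP; exact: continuous_measurable_fun.
- exact: continuous_circle_integrable.
Qed.


Lemma circle_integrableD (R : realType) (u v : R -> R) :
  circle_integrable u -> circle_integrable v ->
  circle_integrable (fun s => u s + v s).
Proof. by move=> iu iv; apply: integrableD iu iv; exact: measurable_circle. Qed.

Lemma circle_integralD (R : realType) (u v : R -> R) :
  circle_integrable u -> circle_integrable v ->
  circle_integral (fun s => u s + v s) = circle_integral u + circle_integral v.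
Proof. by move=> iu iv; apply: RintegralD iu iv; exact: measurable_circle. Qed.

Lemma circle_integrableZ (R : realType) (c : R) (u : R -> R) :
  circle_integrable u -> circle_integrable (fun s => c * u s).
Proof. by move=> iu; apply: integrableZl iu; exact: measurable_circle. Qed.

Lemma circle_integralZ (R : realType) (c : R) (u : R -> R) :
  circle_integrable u ->
  circle_integral (fun s => c * u s) = c * circle_integral u.
Proof. by move=> iu; apply: RintegralZl iu; exact: measurable_circle. Qed.

Lemma circle_integrable_norm (R : realType) (u : R -> R) :
  circle_integrable u -> circle_integrable (fun s => `|u s|).
Proof. exact: integrable_norm. Qed.

Lemma le_circle_integral (R : realType) (u v : R -> R) :
  circle_integrable u -> circle_integrable v -> (forall s, u s <= v s) ->
  circle_integral u <= circle_integral v.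
Proof.
move=> iu iv uv; apply: le_Rintegral iu iv _; first exact: measurable_circle.
by move=> s _; exact: uv.
Qed.

Lemma le_normr_circle_integral (R : realType) (u : R -> R) :
  circle_integrable u ->
  `|circle_integral u| <= circle_integral (fun s => `|u s|).
Proof. by move=> iu; apply: le_normr_Rintegral iu; exact: measurable_circle. Qed.

Lemma circle_integral_cst (R : realType) (c : R) :
  circle_integral (fun=> c) = c * (2 * pi).
Proof.
rewrite /circle_integral Rintegral_cst; last exact: measurable_circle.
congr (_ * _); rewrite mulr_natl; exact: (congr1 fine (mu_circle R)).
Qed.

(** * Integrals of cosines over a period *)

Lemma sinDnpi2 (R : realType) (n : nat) (x : R) :
  sin (x + n%:R * (2 * pi)) = sin x.
Proof. by rewrite mulr_natl (mulr_natl _ 2) (periodicn (@sinD2pi R)). Qed.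

Lemma continuous_cosM (R : realType) (k x : R) :
  continuous (fun s => cos (k * (x - s))).
Proof.
move=> s; apply: (@continuous_comp _ _ _ (fun s => k * (x - s)) cos);
  last exact: continuous_cos.
apply: (@continuousM R R (cst k) (fun s => x - s)); first exact: cvg_cst.
by apply: continuousB; [exact: cvg_cst|exact: cvg_id].
Qed.

(** A cosine of nonzero integer frequency has a periodic primitive, whose values at the two
    endpoints cancel. Writing the frequency as [k.+1] excludes the constant. *)
Lemma circle_integral_cosM (R : realType) (k : nat) (x : R) :
  circle_integral (fun s => cos (k.+1%:R * (x - s))) = 0.
Proof.
rewrite circle_integralE; last exact: continuous_cosM.
have k0 : k.+1%:R != 0 :> R by rewrite pnatr_eq0.
pose F s := - k.+1%:R^-1 * sin (k.+1%:R * (x - s)) : R.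
have dF s : is_derive s (1 : R) F (cos (k.+1%:R * (x - s))).
  rewrite /F; apply: is_derive_eq.
  by rewrite /GRing.scale /=; field; rewrite addrC natr1.
rewrite /Rintegral (@continuous_FTC2 _ (fun s => cos (k.+1%:R * (x - s))) F);
  first last.
- by move=> s _; rewrite derive1E; apply: derive_val.
- have cF : continuous F.
    move=> s; apply: differentiable_continuous; apply/derivable1_diffP.
    by apply: ex_derive.
  split => [s _||]; first exact: ex_derive.
    by apply: cvg_at_right_filter; exact: cF.
  by apply: cvg_at_left_filter; exact: cF.
- by apply: continuous_subspaceT; exact: continuous_cosM.
- by rewrite gtrN ?pi_gt0.
rewrite -EFinB /= /F.
have -> : k.+1%:R * (x - - pi) = k.+1%:R * (x - pi) + k.+1%:R * (2 * pi) :> R.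
  by ring.
by rewrite sinDnpi2 subrr.
Qed.


(** * The Dirichlet and Fejer kernels *)

(** This is the sum of e^(ikt) over |k| <= n, with k and -k paired into a real term; the factor 1/(2
    pi) is kept outside. *)
Definition dirichlet (R : realType) (n : nat) (t : R) : R :=
  1 + \sum_(k < n) 2 * cos (k.+1%:R * t).

(* The sum, not the mean, of the first m Dirichlet kernels. *)
Definition fejer (R : realType) (m : nat) (t : R) : R :=
  \sum_(j < m) dirichlet j t.

(** Since 2 cos(a) cos(t) = cos(a - t) + cos(a + t), the product telescopes. The form without a
    quotient also covers cos t = 1. *)
Lemma dirichletM (R : realType) (n : nat) (t : R) :
  dirichlet n t * (1 - cos t) = cos (n%:R * t) - cos (n.+1%:R * t).
Proof.
elim: n => [|n IH].
  by rewrite /dirichlet big_ord0 addr0 mul1r mul0r cos0 mul1r.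
have -> : dirichlet n.+1 t = dirichlet n t + 2 * cos (n.+1%:R * t).
  by rewrite /dirichlet big_ord_recr addrA.
rewrite mulrDl IH.
have -> : n%:R * t = n.+1%:R * t - t by rewrite -natr1; ring.
have -> : n.+2%:R * t = n.+1%:R * t + t by rewrite -(natr1 n.+1); ring.
rewrite cosB cosD; ring.
Qed.

Lemma fejerM (R : realType) (m : nat) (t : R) :
  fejer m t * (1 - cos t) = 1 - cos (m%:R * t).
Proof.
rewrite /fejer mulr_suml; elim: m => [|m IH].
  by rewrite big_ord0 mul0r cos0 subrr.
by rewrite big_ord_recr /= IH dirichletM; ring.
Qed.

(** Where cos t < 1, divide the identity [fejerM] by 1 - cos t. Where cos t = 1, every cosine in the
    kernel equals 1. *)
Lemma fejer_ge0 (R : realType) (m : nat) (t : R) : 0 <= fejer m t.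
Proof.
have := cos_le1 t; rewrite le_eqVlt => /predU1P[cost1|cost1]; last first.
  rewrite -(@pmulr_lge0 _ (1 - cos t)) ?subr_gt0// fejerM subr_ge0.
  exact: cos_le1.
have sint0 : sin t = 0.
  by apply/eqP; rewrite -sqrf_eq0 sin2cos2 cost1 expr1n subrr.
have cosnt k : cos (k%:R * t) = 1.
  elim: k => [|k IH]; first by rewrite mul0r cos0.
  by rewrite -natr1 mulrDl mul1r cosD cost1 sint0 IH mulr0 subr0 mulr1.
apply: sumr_ge0 => j _; rewrite /dirichlet addr_ge0 // sumr_ge0 // => k _.
by rewrite cosnt mulr1.
Qed.

(** The numerator 1 - cos(mt) never exceeds 2, so away from t = 0 on the circle the bound does not
    grow with m. *)
Lemma fejer_le (R : realType) (m : nat) (t eta : R) :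
  0 < eta -> eta <= 1 - cos t -> fejer m t <= 2 / eta.
Proof.
move=> eta0 etat; rewrite ler_pdivlMr //.
apply: (@le_trans _ _ (fejer m t * (1 - cos t))).
  by rewrite ler_wpM2l // fejer_ge0.
rewrite fejerM; have := cos_geN1 (m%:R * t); lra.
Qed.

Lemma continuous_sum (R : realType) (n : nat) (F : nat -> R -> R) :
  (forall k, continuous (F k)) -> continuous (fun s => \sum_(k < n) F k s).
Proof.
move=> cF; elim: n => [|n IH].
  under [X in continuous X]eq_fun do rewrite big_ord0.
  exact: cst_continuous.
under [X in continuous X]eq_fun do rewrite big_ord_recr/=.
by move=> s; apply: continuousD; [exact: IH|exact: cF].
Qed.

(** Both claims go through one induction: additivity of the integral at each step needs
    integrability of the preceding sum. *)
Lemma circle_integral_sum (R : realType) (n : nat) (F : nat -> R -> R) :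
  (forall k, circle_integrable (F k)) ->
  circle_integrable (fun s => \sum_(k < n) F k s) /\
  circle_integral (fun s => \sum_(k < n) F k s) =
    \sum_(k < n) circle_integral (F k).
Proof.
move=> iF; elim: n => [|n [iS eS]].
  under eq_fun do rewrite big_ord0; rewrite big_ord0; split.
    exact/continuous_circle_integrable/cst_continuous.
  by rewrite circle_integral_cst mul0r.
rewrite big_ord_recr/= -eS; under eq_fun do rewrite big_ord_recr/=.
by split; [exact: circle_integrableD|exact: circle_integralD].
Qed.

Lemma continuous_dirichlet (R : realType) (n : nat) (x : R) :
  continuous (fun s => dirichlet n (x - s)).
Proof.
move=> s; apply: continuousD; first exact: cvg_cst.
apply: (@continuous_sum _ n (fun k s => 2 * cos (k.+1%:R * (x - s)))) => k y.
apply: (@continuousM R R (cst 2)); first exact: cvg_cst.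
exact: continuous_cosM.
Qed.

Lemma continuous_fejer (R : realType) (m : nat) (x : R) :
  continuous (fun s => fejer m (x - s)).
Proof.
apply: (@continuous_sum _ m (fun j s => dirichlet j (x - s))) => k.
exact: continuous_dirichlet.
Qed.

Lemma circle_integral_dirichlet (R : realType) (n : nat) (x : R) :
  circle_integral (fun s => dirichlet n (x - s)) = 2 * pi.
Proof.
have icos k : circle_integrable (fun s : R => cos (k.+1%:R * (x - s))).
  exact/continuous_circle_integrable/continuous_cosM.
have i2cos k : circle_integrable (fun s : R => 2 * cos (k.+1%:R * (x - s))).
  exact: circle_integrableZ.
have [iS eS] := circle_integral_sum n i2cos.
rewrite circle_integralD //; last exact/continuous_circle_integrable/cst_continuous.
rewrite circle_integral_cst mul1r eS big1 ?addr0 // => k _.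
by rewrite circle_integralZ // circle_integral_cosM mulr0.
Qed.

Lemma circle_integral_fejer (R : realType) (m : nat) (x : R) :
  circle_integral (fun s => fejer m (x - s)) = m%:R * (2 * pi).
Proof.
have iD k : circle_integrable (fun s => dirichlet k (x - s)).
  exact/continuous_circle_integrable/continuous_dirichlet.
have [_ ->] := circle_integral_sum m iD.
under eq_bigr do rewrite circle_integral_dirichlet.
by rewrite sumr_const card_ord -[LHS]mulr_natl.
Qed.

(** * Cesaro sums of a real function as Fejer integrals *)

(* The n-th symmetric partial Fourier sum of the real function u. *)
Definition circle_psum (R : realType) (u : R -> R) (n : nat) (x : R) : R :=
  (2 * pi)^-1 * circle_integral (fun s => u s * dirichlet n (x - s)).

Lemma sum_circle_psum (R : realType) (u : R -> R) (m : nat) (x c : R) :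
  circle_integrable u ->
  \sum_(j < m) (circle_psum u j x - c) =
  (2 * pi)^-1 * circle_integral (fun s => (u s - c) * fejer m (x - s)).
Proof.
move=> iu.
have iD k : circle_integrable (fun s => dirichlet k (x - s)).
  exact/continuous_circle_integrable/continuous_dirichlet.
have iuD k : circle_integrable (fun s => u s * dirichlet k (x - s)).
  by apply: circle_integrableM => //; exact: continuous_dirichlet.
have icD k : circle_integrable (fun s => - c * dirichlet k (x - s)).
  exact: circle_integrableZ.
(* The Dirichlet kernel has mean 1, so the constant c can be moved under the integral. *)
have e1 k : circle_psum u k x - c = (2 * pi)^-1 *
    circle_integral (fun s => (u s - c) * dirichlet k (x - s)).
  under [in RHS]eq_fun do rewrite mulrDl.
  rewrite circle_integralD // circle_integralZ // circle_integral_dirichlet.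
  by rewrite mulrDr mulrCA mulVf ?mulr1 // mulf_neq0 // gt_eqF // pi_gt0.
under eq_bigr do rewrite e1.
rewrite -mulr_sumr; congr (_ * _).
have iucD k : circle_integrable (fun s => (u s - c) * dirichlet k (x - s)).
  by under eq_fun do rewrite mulrDl; exact: circle_integrableD.
have [_ <-] := circle_integral_sum m iucD.
by congr circle_integral; apply/funext => s; rewrite mulr_sumr.
Qed.

(** The second term depends on neither m nor x, so the bound is o(m) uniformly once eps is
    arbitrary. *)
Lemma fejer_bound (R : realType) (u : R -> R) (m : nat) (x c M eps eta : R) :
  circle_integrable u -> 0 < eta -> 0 <= eps -> `|c| <= M ->
  (forall s, 1 - cos (x - s) < eta -> `|u s - c| <= eps) ->
  `|\sum_(j < m) (circle_psum u j x - c)| <= eps * m%:R +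
    (2 * pi)^-1 * (2 / eta * (circle_integral (fun s => `|u s|) + M * (2 * pi))).
Proof.
move=> iu eta0 eps0 cM near_c.
have pi20 : 0 < (2 * pi : R) by rewrite mulr_gt0 // pi_gt0.
have ic (r : R) : circle_integrable (fun=> r).
  exact/continuous_circle_integrable/cst_continuous.
have iF : circle_integrable (fun s => fejer m (x - s)).
  exact/continuous_circle_integrable/continuous_fejer.
have iuF : circle_integrable (fun s => (u s - c) * fejer m (x - s)).
  apply: circle_integrableM; last exact: continuous_fejer.
  exact: (circle_integrableD iu (ic (- c))).
have iuM : circle_integrable (fun s => `|u s| + M).
  by apply: circle_integrableD => //; exact: circle_integrable_norm.
rewrite sum_circle_psum // normrM ger0_norm ?invr_ge0 ?(ltW pi20) //.
have -> : eps * m%:R = (2 * pi)^-1 * (eps * (m%:R * (2 * pi))).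
  by rewrite [RHS]mulrC [eps * (_ * _)]mulrA mulfK // gt_eqF.
rewrite -mulrDr ler_wpM2l ?invr_ge0 ?(ltW pi20) //.
apply: (le_trans (le_normr_circle_integral iuF)).
(* The right-hand side is turned into a single integral, so that the integrands can be compared
   pointwise. *)
rewrite -(circle_integral_fejer m x) -circle_integralZ //.
rewrite -(circle_integral_cst M) -circle_integralD //;
  last exact: circle_integrable_norm.
rewrite -[in leRHS]circle_integralZ // -circle_integralD; last 2 first.
- exact: circle_integrableZ.
- exact: circle_integrableZ.
apply: le_circle_integral.
- exact: circle_integrable_norm.
- by apply: circle_integrableD; exact: circle_integrableZ.
move=> s; have F0 := fejer_ge0 m (x - s).
have M0 : 0 <= `|u s| + M by rewrite addr_ge0 // (le_trans _ cM).
(* Near x the oscillation of u is small; away from x the kernel is bounded. *)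
have [near|far] := ltP (1 - cos (x - s)) eta.
  rewrite normrM (ger0_norm F0) ler_wpDr //; last by rewrite ler_wpM2r // near_c.
  by rewrite mulr_ge0 // divr_ge0 // ltW.
rewrite normrM (ger0_norm F0) ler_wpDl //; first by rewrite mulr_ge0.
rewrite mulrC ler_pM // ?fejer_le //.
by rewrite (le_trans (ler_normB _ _)) // lerD2l.
Qed.


(** * Fourier sums of f through its real and imaginary parts *)

(** Passing from n to n+1 adds one term at each end of the centered sum; these form the pair with
    indices n+1 and -(n+1). *)
Lemma sum_centered (V : zmodType) (g : int -> V) (n : nat) :
  \sum_(j < n.*2.+1) g (j%:Z - n%:Z) =
  g 0 + \sum_(k < n) (g k.+1%:Z + g (- k.+1%:Z)).
Proof.
elim: n => [|n IH]; first by rewrite big_ord1 big_ord0 !addr0.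
rewrite doubleS big_ord_recl big_ord_recr /= [in RHS]big_ord_recr /=.
rewrite [in RHS]addrA -IH [g n.+1%:Z + _]addrC addrCA.
congr (_ + (_ + _)); first by rewrite sub0r.
- by apply: eq_bigr => i _; congr g; rewrite /bump leq0n; lia.
- by congr g; rewrite /bump leq0n -addnn; lia.
Qed.

Lemma ReD (R : realType) (a b : R[i]) : Re (a + b) = Re a + Re b.
Proof. by case: a b => [? ?] [? ?]. Qed.

Lemma ImD (R : realType) (a b : R[i]) : Im (a + b) = Im a + Im b.
Proof. by case: a b => [? ?] [? ?]. Qed.

Lemma ReM (R : realType) (a b : R[i]) : Re (a * b) = Re a * Re b - Im a * Im b.
Proof. by case: a b => [? ?] [? ?]. Qed.

Lemma ImM (R : realType) (a b : R[i]) : Im (a * b) = Re a * Im b + Im a * Re b.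
Proof. by case: a b => [? ?] [? ?]. Qed.

Lemma continuous_sinM (R : realType) (k x : R) :
  continuous (fun s => sin (k * (x - s))).
Proof.
move=> s; apply: (@continuous_comp _ _ _ (fun s => k * (x - s)) sin).
  apply: (@continuousM R R (cst k) (fun s => x - s)); first exact: cvg_cst.
  by apply: continuousB; [exact: cvg_cst|exact: cvg_id].
exact: continuous_sin.
Qed.

Lemma circle_integrable_parts (R : realType) (f : R -> R[i]) (b x : R) :
  cintegrable `[- pi, pi] f ->
  circle_integrable (fun s => Re (f s * expi (b * (x - s)))) /\
  circle_integrable (fun s => Im (f s * expi (b * (x - s)))).
Proof.
move=> [iu iv].
have icos (w : R -> R) : circle_integrable w ->
    circle_integrable (fun s => w s * cos (b * (x - s))).
  by move=> iw; apply: circle_integrableM iw _; exact: continuous_cosM.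
have isin (w : R -> R) : circle_integrable w ->
    circle_integrable (fun s => w s * sin (b * (x - s))).
  by move=> iw; apply: circle_integrableM iw _; exact: continuous_sinM.
split.
  under eq_fun do rewrite ReM -[X in _ + X]mulN1r.
  by apply: circle_integrableD; [exact: icos|apply/circle_integrableZ/isin].
under eq_fun do rewrite ImM.
by apply: circle_integrableD; [exact: isin|exact: icos].
Qed.

(** The factor e^(ikx) is constant in s. Linearity is applied to real and imaginary parts, since
    [cintegral] is defined by components. *)
Lemma fourier_termE (R : realType) (f : R -> R[i]) (k : int) (x : R) :
  cintegrable `[- pi, pi] f ->
  fourier_coef f k * expi (k%:~R * x) = ((2 * pi)^-1)%:C *
  cintegral `[- pi, pi] (fun s => f s * expi (k%:~R * (x - s))).
Proof.
move=> If; rewrite /fourier_coef -mulrA; congr (_ * _).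
pose a : R := k%:~R.
have [iRe iIm] := circle_integrable_parts a 0 If.
have -> : (fun s => f s * expi (- (k%:~R * s))) =
    (fun s => f s * expi (a * (0 - s))).
  by apply/funext => s; rewrite sub0r mulrN.
have Ex s : f s * expi (a * (x - s)) = f s * expi (a * (0 - s)) * expi (a * x).
  rewrite -mulrA; congr (_ * _); rewrite sub0r mulrBr mulrN.
  apply/eqP; rewrite eq_complex /= cosB sinB cosN sinN.
  by apply/andP; split; apply/eqP; ring.
have -> : (fun s => f s * expi (k%:~R * (x - s))) =
    (fun s => f s * expi (a * (0 - s)) * expi (a * x)).
  by apply/funext => s; exact: Ex.
pose p s := Re (f s * expi (a * (0 - s))).
pose q s := Im (f s * expi (a * (0 - s))).
apply/eqP; rewrite eq_complex /=; apply/andP; split; apply/eqP.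
  have -> : (fun s => Re (f s * expi (a * (0 - s)) * expi (a * x))) =
      (fun s => cos (a * x) * p s + - sin (a * x) * q s).
    by apply/funext => s; rewrite ReM /= /p /q; ring.
  apply: esym; apply: etrans (circle_integralD
    (circle_integrableZ (cos (a * x)) iRe)
    (circle_integrableZ (- sin (a * x)) iIm)) _.
  rewrite circle_integralZ // circle_integralZ //.
  by rewrite mulNr mulrC [sin _ * _]mulrC.
have -> : (fun s => Im (f s * expi (a * (0 - s)) * expi (a * x))) =
    (fun s => sin (a * x) * p s + cos (a * x) * q s).
  by apply/funext => s; rewrite ImM /= /p /q; ring.
apply: esym; apply: etrans (circle_integralD
  (circle_integrableZ (sin (a * x)) iRe)
  (circle_integrableZ (cos (a * x)) iIm)) _.
rewrite circle_integralZ // circle_integralZ //.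
by rewrite mulrC [cos _ * _]mulrC.
Qed.

Lemma fourier_term0 (R : realType) (f : R -> R[i]) (x : R) :
  cintegrable `[- pi, pi] f ->
  fourier_coef f 0 * expi (0%:~R * x) = ((2 * pi)^-1)%:C *
  cintegral `[- pi, pi] f.
Proof.
move=> If; rewrite fourier_termE //; congr (_ * cintegral _ _).
apply/funext => s; rewrite mul0r /expi cos0 sin0; exact: mulr1.
Qed.

(** Opposite frequencies cancel the sines and double the cosines; the kernel becomes real and so
    does not mix the two parts of f. *)
Lemma fourier_term_pair (R : realType) (f : R -> R[i]) (k : nat) (x : R) :
  cintegrable `[- pi, pi] f ->
  fourier_coef f k.+1%:Z * expi (k.+1%:Z%:~R * x) +
  fourier_coef f (- k.+1%:Z) * expi ((- k.+1%:Z)%:~R * x) =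
  ((2 * pi)^-1)%:C *
  (circle_integral (fun s => Re (f s) * (2 * cos (k.+1%:R * (x - s)))) +i*
   circle_integral (fun s => Im (f s) * (2 * cos (k.+1%:R * (x - s))))).
Proof.
move=> If; rewrite !fourier_termE // -mulrDr; congr (_ * _).
have [iRe iIm] := circle_integrable_parts k.+1%:Z%:~R x If.
have [iReN iImN] := circle_integrable_parts (- k.+1%:Z)%:~R x If.
have eN s : (- k.+1%:Z)%:~R * (x - s) = - (k.+1%:R * (x - s)) :> R.
  by rewrite mulrNz mulNr.
apply/eqP; rewrite eq_complex /=; apply/andP; split; apply/eqP.
  have /= <- := circle_integralD iRe iReN.
  congr circle_integral; apply/funext => s.
  by rewrite !ReM eN /= cosN sinN -pmulrn; ring.
have /= <- := circle_integralD iIm iImN.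
congr circle_integral; apply/funext => s.
by rewrite !ImM eN /= cosN sinN -pmulrn; ring.
Qed.

Lemma fourier_sumE (R : realType) (f : R -> R[i]) (n : nat) (x : R) :
  fourier_sum f n x = fourier_coef f 0 * expi (0%:~R * x) +
  \sum_(k < n) (fourier_coef f k.+1%:Z * expi (k.+1%:Z%:~R * x) +
  fourier_coef f (- k.+1%:Z) * expi ((- k.+1%:Z)%:~R * x)).
Proof.
exact: (sum_centered (fun k => fourier_coef f k * expi (k%:~R * x))).
Qed.

Lemma circle_psum0 (R : realType) (u : R -> R) (x : R) :
  circle_psum u 0 x = (2 * pi)^-1 * circle_integral u.
Proof.
congr (_ * circle_integral _); apply/funext => s.
by rewrite /dirichlet big_ord0 addr0 mulr1.
Qed.

Lemma circle_psumS (R : realType) (u : R -> R) (n : nat) (x : R) :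
  circle_integrable u ->
  circle_psum u n.+1 x = circle_psum u n x + (2 * pi)^-1 *
    circle_integral (fun s => u s * (2 * cos (n.+1%:R * (x - s)))).
Proof.
move=> iu; rewrite /circle_psum -mulrDr -circle_integralD.
- congr (_ * circle_integral _); apply/funext => s.
  by rewrite -mulrDr /dirichlet big_ord_recr addrA.
- by apply: circle_integrableM => //; exact: continuous_dirichlet.
- apply: circle_integrableM => // s.
  by apply: (@continuousM R R (cst 2)); [exact: cvg_cst|exact: continuous_cosM].
Qed.

Lemma fourier_sum_parts (R : realType) (f : R -> R[i]) (n : nat) (x : R) :
  cintegrable `[- pi, pi] f ->
  fourier_sum f n x = circle_psum (fun s => Re (f s)) n x +i*
                      circle_psum (fun s => Im (f s)) n x.
Proof.
move=> If; have [iu iv] := If; rewrite fourier_sumE fourier_term0 //.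
elim: n => [|n IH].
  rewrite big_ord0 addr0 !circle_psum0; apply/eqP.
  by rewrite eq_complex ReM ImM /= !mul0r subr0 addr0 !eqxx.
rewrite big_ord_recr /= addrA IH fourier_term_pair // !circle_psumS //.
by apply/eqP; rewrite eq_complex ReD ImD ReM ImM /= !mul0r subr0 addr0 !eqxx.
Qed.

(** * Periodicity and uniform continuity at the points of K *)

(** The codomain is arbitrary so that the lemma also applies to [K], seen as a function into
    propositions. *)
Lemma periodicz (R : realType) (T : Type) (g : R -> T) (c : R) :
  (forall x, g (x + c) = g x) -> forall (k : int) x, g (x + k%:~R * c) = g x.
Proof.
move=> gc; have gn n x : g (x + n%:R * c) = g x.
  by elim: n x => [|n IH] x; rewrite ?mul0r ?addr0 // -natr1 mulrDl mul1r addrA gc.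
case=> n x; first by rewrite -pmulrn.
by rewrite NegzE -(gn n.+1) mulrNz mulNr -pmulrn subrK.
Qed.

Lemma translate_near (R : realType) (x y : R) :
  exists k : int, `|x + k%:~R * (2 * pi) - y| <= pi.
Proof.
have p0 := pi_gt0 R; have p20 : 0 < (2 * pi : R) by rewrite mulr_gt0.
(* Adding pi before dividing turns the floor into rounding to a nearest integer. *)
exists (Num.floor ((y - x + pi) / (2 * pi))).
have := floor_itv ((y - x + pi) / (2 * pi)).
set k := (Num.floor _)%:~R; rewrite ler_pdivlMr // intrD.
rewrite ltr_pdivrMr // => /andP[k1 k2].
by rewrite ler_norml; apply/andP; split; lra.
Qed.

(** Only x is confined to A; y ranges over the whole line, as an integral over a full period
    requires. Compactness, in its near-covering form, makes the continuity radii uniform. *)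
Lemma compact_modulus (R : realType) (A : set R) (u : R -> R) (eps : R) :
  compact A -> (forall x, A x -> {for x, continuous u}) -> 0 < eps ->
  exists2 d, 0 < d & forall x y, A x -> `|x - y| < d -> `|u x - u y| < eps.
Proof.
move=> /compact_near_coveringP cA cu eps0.
have [] := cA R (0 : R)^'+
  (fun d x => forall y, `|x - y| < d -> `|u x - u y| < eps) _ _.
  move=> x Ax; have e20 : 0 < eps / 2 by rewrite divr_gt0.
  have /cvgrPdist_lt/(_ _ e20) := cu x Ax.
  move=> /nbhs_ballP[r /= r0 hr].
  have r20 : 0 < r / 2 by rewrite divr_gt0.
  exists (ball x (r / 2), [set d | d < r / 2]) => /=.
    by split; [exact: nbhsx_ballx|exact: nbhs_right_lt].
  move=> [x' d] /= [xx' dr] y x'y.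
  have h1 : `|u x - u x'| < eps / 2.
    by apply: hr; apply: lt_le_trans xx' _; lra.
  have h2 : `|u x - u y| < eps / 2.
    apply: hr; rewrite /ball /= (le_lt_trans (ler_distD x' _ _)) //.
    by rewrite [ltRHS](splitr r) ltrD // (lt_trans x'y).
  rewrite (le_lt_trans (ler_distD (u x) _ _)) // (splitr eps) ltrD //.
  by rewrite distrC.
(* The radii that work fill the open interval from 0 to d, so a point inside it is taken. *)
move=> d /= d0 hd; exists (d / 2); first by rewrite divr_gt0.
move=> x y Ax xy; apply: hd Ax y xy; rewrite /= ?divr_gt0 //.
by rewrite sub0r normrN ger0_norm ?ltr_pdivrMr //; lra.
Qed.

(* 1 - cos (x - s) measures the distance between x and s on the circle. *)
Lemma periodic_modulus (R : realType) (K : set R) (u : R -> R) (eps : R) :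
  periodic u (2 * pi) -> periodic_set K -> closed K ->
  (forall x, K x -> {for x, continuous u}) -> 0 < eps ->
  exists2 eta, 0 < eta &
    forall x s, K x -> 1 - cos (x - s) < eta -> `|u s - u x| <= eps.
Proof.
move=> pu pK clK cu eps0; have p0 := pi_gt0 R.
have cosz := periodicz (g := @cos R) (c := 2 * pi).
have cA : compact (K `&` `[- pi, pi]).
  by rewrite setIC; apply: compact_closedI => //; exact: segment_compact.
have [d d0 hd] := compact_modulus cA (fun x Ax => cu x Ax.1) eps0.
(* Capping at pi keeps e in the interval [0, pi], where cosine is strictly decreasing and can be
   inverted. *)
pose e := Num.min d pi.
have e0 : 0 < e by rewrite lt_min d0.
have epi : e <= pi by rewrite ge_min lexx orbT.
exists (1 - cos e).
  rewrite subr_gt0 -(cos0 R) ltr_cos // in_itv /= ?lexx ?(ltW p0) //.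
  by rewrite (ltW e0).
move=> x s Kx; rewrite ltrD2l ltrN2 => cosxs.
(* Replace x by its translate in [-pi, pi], and s by its translate within pi of that point. *)
have [k xk] := translate_near x 0.
have [l sl] := translate_near s (x + k%:~R * (2 * pi)).
move: xk sl; set x0 := x + _; set s0 := s + _ => xk sl.
have -> : u s = u s0 by rewrite /s0 (periodicz pu).
have -> : u x = u x0 by rewrite /x0 (periodicz pu).
have Kx0 : K x0.
  by rewrite /x0 (periodicz (g := K)) // => y; apply/propext; exact: pK.
have cosE : cos (x - s) = cos `|x0 - s0|.
  have -> : cos `|x0 - s0| = cos (x0 - s0).
    by case: (ger0P (x0 - s0)) => _ //; rewrite cosN.
  rewrite -(cosz _ (k - l)); last by move=> y; rewrite mulr_natl cosD2pi.
  by congr cos; rewrite /x0 /s0 intrB; ring.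
rewrite distrC; apply/ltW/hd.
  by split => //=; rewrite in_itv /= -ler_norml; rewrite subr0 in xk.
move: cosxs; rewrite cosE ltr_cos ?in_itv /= ?(ltW e0) ?epi //.
  by move=> /lt_le_trans; apply; rewrite ge_min lexx.
by rewrite normr_ge0 distrC.
Qed.

Lemma periodic_bounded (R : realType) (K : set R) (u : R -> R) :
  periodic u (2 * pi) -> periodic_set K -> closed K ->
  (forall x, K x -> {for x, continuous u}) ->
  exists M, forall x, K x -> `|u x| <= M.
Proof.
move=> pu pK clK cu.
have cA : compact (K `&` `[- pi, pi]).
  by rewrite setIC; apply: compact_closedI => //; exact: segment_compact.
have : compact (u @` (K `&` `[- pi, pi])).
  apply: continuous_compact cA; apply: continuous_in_subspaceT => x.
  by rewrite inE => -[Kx _]; exact: cu.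
move=> /compact_bounded[M [_ hM]]; exists (M + 1) => x Kx.
have [k xk] := translate_near x 0; rewrite subr0 in xk.
apply: (hM (M + 1)); first by rewrite ltrDl.
exists (x + k%:~R * (2 * pi)); last by rewrite (periodicz pu).
split; last by rewrite /= in_itv /= -ler_norml.
by rewrite (periodicz (g := K)) // => y; apply/propext; exact: pK.
Qed.

(** Half of eps covers the oscillation near x; the constant [B], free of m and x, is at most (eps /
    2) m for m large. *)
Lemma fejer_uniform (R : realType) (K : set R) (u : R -> R) (eps : R) :
  circle_integrable u -> periodic u (2 * pi) -> periodic_set K -> closed K ->
  (forall x, K x -> {for x, continuous u}) -> 0 < eps ->
  \forall m \near \oo, forall x, K x ->
    `|\sum_(j < m) (circle_psum u j x - u x)| <= eps * m%:R.
Proof.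
move=> iu pu pK clK cu eps0; have e20 : 0 < eps / 2 by rewrite divr_gt0.
have [M hM] := periodic_bounded pu pK clK cu.
have [eta eta0 heta] := periodic_modulus pu pK clK cu e20.
pose B := (2 * pi)^-1 *
  (2 / eta * (circle_integral (fun s => `|u s|) + M * (2 * pi))).
near=> m => x Kx.
apply: (le_trans (fejer_bound m iu eta0 (ltW e20) (hM x Kx) _)).
  by move=> s; exact: heta.
rewrite -/B {2}(splitr eps) mulrDl lerD2l mulrC -ler_pdivrMr //.
near: m; exact: nbhs_infty_ger.
Unshelve. all: by end_near. Qed.


(** * Differences of partial sums and the coefficient tail *)

(* If a > tau then a <= a * (a / tau) ^ (p - 1); this replaces Hoelder's
   inequality in the tail estimate. *)
Lemma le_add_powR (R : realType) (a tau p : R) :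
  0 <= a -> 0 < tau -> 1 < p -> a <= tau + a `^ p / tau `^ (p - 1).
Proof.
move=> a0 tau0 p1.
have tp0 : 0 < tau `^ (p - 1) by rewrite powR_gt0.
have [atau|taua] := leP a tau.
  by rewrite ler_wpDr // divr_ge0 ?powR_ge0 // ltW.
rewrite ler_wpDl ?(ltW tau0) // ler_pdivlMr //.
have -> : a `^ p = a `^ (1 + (p - 1)) by congr powR; ring.
rewrite [a `^ _]powRD; last by apply/implyP => _; rewrite gt_eqF // (lt_trans tau0).
rewrite powRr1 // ler_wpM2l // ge0_ler_powR ?nnegrE ?(ltW tau0) ?(ltW taua) //.
by rewrite subr_ge0 ltW.
Qed.

Lemma fourier_tail_ge (R : realType) (f : R -> R[i]) (p : R) (n j : nat) :
  ((\sum_(n <= k < j) (normc (fourier_coef f k.+1%:Z) `^ p +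
                       normc (fourier_coef f (- k.+1%:Z)) `^ p))%:E
   <= fourier_tail f p n)%E.
Proof.
(* [Negz k] is -(k+1), so the two disjoint lists hold exactly the integers of absolute value k+1 for
   n <= k < j. *)
pose r := [seq Posz k.+1 | k <- index_iota n j] ++ [seq Negz k | k <- index_iota n j].
have rP (k : int) : k \in r -> (n.+1 <= `|k|)%N.
  by rewrite mem_cat => /orP[|] /mapP[m]; rewrite mem_index_iota => /andP[ni _] ->.
apply: esum_ge; exists [set` r]; first by split; [exact: finite_seq|exact: rP].
rewrite -fsbig_seq; last first.
  rewrite cat_uniq !map_inj_uniq ?iota_uniq /=; [|by move=> ? ? []|by move=> ? ? []].
  by rewrite andbT; apply/hasPn => k /mapP[m _ ->]; apply/negP => /mapP[].
by rewrite sumEFin lee_fin big_cat /= !big_map big_split.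
Qed.

Lemma normc_expi (R : realType) (x : R) : normc (expi x) = 1.
Proof. by rewrite /expi /= cos2Dsin2 sqrtr1. Qed.

Lemma normc_sum (R : realType) (I : Type) (r : seq I) (P : pred I) (F : I -> R[i]) :
  normc (\sum_(i <- r | P i) F i) <= \sum_(i <- r | P i) normc (F i).
Proof.
elim/big_ind2 : _ => //; first by rewrite Normc.normc0.
by move=> a x b y ax bY; rewrite (le_trans (le_normcD _ _)) // lerD.
Qed.

(** The difference has 2 (j - n) terms, each bounded by [le_add_powR] with the same threshold
    tau. *)
Lemma fourier_sumB (R : realType) (f : R -> R[i]) (n j : nat) (x tau p : R) :
  (n <= j)%N -> 0 < tau -> 1 < p ->
  normc (fourier_sum f j x - fourier_sum f n x) <=
  2 * tau * (j - n)%:R + (\sum_(n <= k < j)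
    (normc (fourier_coef f k.+1%:Z) `^ p +
     normc (fourier_coef f (- k.+1%:Z)) `^ p)) / tau `^ (p - 1).
Proof.
move=> nj tau0 p1.
pose G k := fourier_coef f k.+1%:Z * expi (k.+1%:Z%:~R * x) +
  fourier_coef f (- k.+1%:Z) * expi ((- k.+1%:Z)%:~R * x).
have SE m : fourier_sum f m x =
    fourier_coef f 0 * expi (0%:~R * x) + \sum_(0 <= k < m) G k.
  by rewrite fourier_sumE big_mkord.
have normc_ge0 (z : R[i]) : 0 <= normc z by case: z => ? ?; exact: sqrtr_ge0.
have pair_le (a b : R[i]) (y z : R) : normc (a * expi y + b * expi z) <=
    2 * tau + (normc a `^ p + normc b `^ p) / tau `^ (p - 1).
  rewrite (le_trans (le_normcD _ _)) // !Normc.normcM !normc_expi !mulr1.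
  rewrite [(_ + _ `^ p) * _]mulrDl mulr_natl mulr2n addrACA.
  by apply: lerD; apply: le_add_powR.
have -> : fourier_sum f j x - fourier_sum f n x = \sum_(n <= k < j) G k.
  by rewrite !SE (big_cat_nat (leq0n n) nj) /=; ring.
have -> : 2 * tau * (j - n)%:R = \sum_(n <= k < j) (2 * tau).
  by rewrite sumr_const_nat mulr_natr.
rewrite (le_trans (normc_sum _ _ _)) // mulr_suml -big_split.
by apply: ler_sum => k _; exact: pair_le.
Qed.

(** * Delayed means and the Cesaro estimate for complex f *)

(* The sum of D over [n, n + l) is a difference of two Cesaro sums. *)
Lemma delayed_mean (R : realType) (D : nat -> R[i]) (n l : nat) (b A : R) :
  normc (\sum_(j < n + l) D j) <= b -> normc (\sum_(j < n) D j) <= b ->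
  (forall i, (i < l)%N -> normc (D (n + i)%N - D n) <= A) ->
  normc (D n) * l%:R <= 2 * b + A * l%:R.
Proof.
move=> hnl hn hA.
have -> : normc (D n) * l%:R = normc (D n *+ l).
  by rewrite normcMn mulr_natr.
have -> : D n *+ l = \sum_(j < n + l) D j - \sum_(j < n) D j -
    \sum_(i < l) (D (n + i)%N - D n).
  by rewrite big_split_ord /= sumrB sumr_const card_ord; ring.
apply: (le_trans (le_normcD _ _)); rewrite normcN lerD //.
  by rewrite (le_trans (le_normcD _ _)) // normcN mulr_natl mulr2n lerD.
apply: (le_trans (normc_sum _ _ _)).
rewrite mulr_natr -[l in leRHS]card_ord -sumr_const; apply: ler_sum => i _.
exact: hA.
Qed.


Lemma sum_complex (R : realType) (n : nat) (F G : nat -> R) :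
  \sum_(j < n) (F j +i* G j) = (\sum_(j < n) F j) +i* (\sum_(j < n) G j).
Proof.
elim: n => [|n IH]; first by rewrite !big_ord0.
by rewrite !big_ord_recr /= IH.
Qed.

Lemma normc_le_parts (R : realType) (a b : R) : normc (a +i* b) <= `|a| + `|b|.
Proof.
have -> : a +i* b = (a +i* 0) + (0 +i* b).
  by apply/eqP; rewrite eq_complex /= addr0 add0r !eqxx.
rewrite (le_trans (le_normcD _ _)) //= !expr0n /= addr0 add0r.
by rewrite !sqrtr_sqr.
Qed.

Lemma continuous_parts (R : realType) (f : R -> R[i]) (x : R) :
  continuity_set f x ->
  {for x, continuous (fun s => Re (f s))} /\
  {for x, continuous (fun s => Im (f s))}.
Proof.
move=> cf.
have near_f (e : R) : 0 < e ->
    \forall y \near x, normc (f x - f y) < e.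
  (* The norm of R[i] takes values in R[i], so the radius is embedded there. *)
  move=> e0; have e0' : 0 < e%:C :> R[i] by rewrite ltcR.
  have /cvgrPdist_lt/(_ _ e0') := cf.
  by apply: filterS => y; rewrite /Num.norm /= ltcR.
split; apply/cvgrPdist_lt => e /near_f; apply: filterS => y.
  apply: le_lt_trans; case: (f x) (f y) => [a b] [c d] /=.
  by rewrite -sqrtr_sqr ler_wsqrtr // lerDl sqr_ge0.
apply: le_lt_trans; case: (f x) (f y) => [a b] [c d] /=.
by rewrite -sqrtr_sqr ler_wsqrtr // lerDr sqr_ge0.
Qed.

Lemma fourier_cesaro (R : realType) (f : R -> R[i]) (K : set R) (eps : R) :
  L1_circle f -> periodic_set K -> closed K -> K `<=` continuity_set f ->
  0 < eps ->
  \forall m \near \oo, forall x, K x ->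
    normc (\sum_(j < m) (fourier_sum f j x - f x)) <= eps * m%:R.
Proof.
move=> [pf If] pK clK cf eps0; have [iu iv] := If.
have e20 : 0 < eps / 2 by rewrite divr_gt0.
have pu : periodic (fun s => Re (f s)) (2 * pi) by move=> s; rewrite pf.
have pv : periodic (fun s => Im (f s)) (2 * pi) by move=> s; rewrite pf.
have hu := fejer_uniform iu pu pK clK
  (fun x Kx => (continuous_parts (cf x Kx)).1) e20.
have hv := fejer_uniform iv pv pK clK
  (fun x Kx => (continuous_parts (cf x Kx)).2) e20.
near=> m => x Kx.
have -> : \sum_(j < m) (fourier_sum f j x - f x) =
    (\sum_(j < m) (circle_psum (fun s => Re (f s)) j x - Re (f x))) +i*
    (\sum_(j < m) (circle_psum (fun s => Im (f s)) j x - Im (f x))).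
  apply: etrans (sum_complex m
    (fun j => circle_psum (fun s => Re (f s)) j x - Re (f x))
    (fun j => circle_psum (fun s => Im (f s)) j x - Im (f x))).
  apply: eq_bigr => j _.
  by rewrite fourier_sum_parts //; case: (f x).
rewrite (le_trans (normc_le_parts _ _)) //.
rewrite (splitr eps) mulrDl lerD //.
- by move: x Kx; near: m.
- by move: x Kx; near: m.
Unshelve. all: by end_near. Qed.

(** * From Cesaro sums to uniform convergence on K *)

(** Error budget, relative to l: the two Cesaro sums cost eps/8 each and the differences S_(n+i) -
    S_n cost eps/4, in total eps/2. *)
Lemma fourier_sum_uniform (R : realType) (f : R -> R[i]) (p : R) (K : set R)
    (eps : R) :
  L1_circle f -> 1 < p ->
  (exists C : R, \forall n \near \oo,
     (fourier_tail f p n <= (C / n%:R `^ (p - 1))%:E)%E) ->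
  periodic_set K -> closed K -> K `<=` continuity_set f -> 0 < eps ->
  \forall n \near \oo, forall x, K x -> normc (fourier_sum f n x - f x) < eps.
Proof.
move=> f_L1 p1 [C tailC] pK clK cf eps0.
have p10 : 0 < p - 1 by rewrite subr_gt0.
(* Chosen so that C / M <= eps/8; the added 1 keeps M positive when C = 0. *)
pose M := 8 * (`|C| + 1) / eps.
have C10 : 0 < `|C| + 1 by rewrite ltr_wpDl.
have M0 : 0 < M by rewrite divr_gt0 // mulr_gt0.
(* Here [mu] is the value of tau n, and M is its power of exponent p - 1. *)
pose mu := M `^ (p - 1)^-1.
have mu0 : 0 < mu by rewrite powR_gt0.
have muM : mu `^ (p - 1) = M by rewrite -powRrM mulVf ?gt_eqF // powRr1 // ltW.
have CM : C / M <= eps / 8.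
  rewrite /M invf_div mulrA ler_pdivrMr ?mulr_gt0 //.
  rewrite (_ : eps / 8 * _ = (`|C| + 1) * eps); last by field.
  by rewrite ler_wpM2r ?(ltW eps0) // (le_trans (ler_norm C)) // lerDl.
pose L := (Num.bound (16 * mu / eps)).+1.
have L0 : 0 < L%:R :> R by rewrite ltr0n.
have muL : 2 * mu <= eps / 8 * L%:R.
  have : 16 * mu / eps <= L%:R.
    rewrite (le_trans (ltW (archi_boundP _)))
      ?divr_ge0 ?mulr_ge0 ?(ltW mu0) ?(ltW eps0) //.
    by rewrite ler_nat.
  by rewrite ler_pdivrMr //; lra.
(* Since n + l <= (L + 1) l, the Cesaro bound e (n + l) is at most (eps/8) l. *)
pose e := eps / (8 * (L%:R + 1)).
have e0 : 0 < e by rewrite divr_gt0 // mulr_gt0 // addr_gt0.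
have eL : e * (L%:R + 1) = eps / 8.
  by rewrite /e; field; rewrite gt_eqF // addr_gt0.
have [N _ hN] := fourier_cesaro f_L1 pK clK cf e0.
near=> n => x Kx.
have n0 : 0 < n%:R :> R by rewrite ltr0n; near: n; exact: nbhs_infty_gt.
have Nn : (N <= n)%N by near: n; exact: nbhs_infty_ge.
have tn : (fourier_tail f p n <= (C / n%:R `^ (p - 1))%:E)%E by near: n.
(* With the successor, n <= l L and l > 0, while every i < l still satisfies i <= n / L. *)
pose l := (n %/ L).+1.
have l0 : 0 < l%:R :> R by rewrite ltr0n.
have nlL : n%:R <= l%:R * L%:R :> R by rewrite -natrM ler_nat ltnW // ltn_ceil.
have nL : (n %/ L)%:R * L%:R <= n%:R :> R by rewrite -natrM ler_nat leq_trunc_div.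
pose tau := mu / n%:R.
have tau0 : 0 < tau by rewrite divr_gt0.
have tau20 : 0 <= 2 * tau by apply: mulr_ge0 => //; exact: ltW.
have taun : tau `^ (p - 1) * n%:R `^ (p - 1) = M.
  by rewrite -powRM ?(ltW tau0) ?(ltW n0) // /tau divfK // gt_eqF.
have step i : (i < l)%N ->
    normc ((fourier_sum f (n + i) x - f x) - (fourier_sum f n x - f x)) <= eps / 4.
  move=> il; rewrite opprB addrA subrK.
  rewrite (le_trans (fourier_sumB f x (leq_addr i n) tau0 p1)) //.
  rewrite (_ : eps / 4 = eps / 8 + eps / 8); last by field.
  apply: lerD.
    rewrite addKn (@le_trans _ _ (2 * tau * (n %/ L)%:R)) //.
      by rewrite (ler_wpM2l tau20) // ler_nat.
    rewrite -(ler_pM2r L0) (le_trans _ muL) // -[X in X <= _]mulrA.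
    rewrite (le_trans (ler_wpM2l tau20 nL)) //.
    by rewrite /tau -mulrA divfK // gt_eqF.
  (* Dividing the tail bound C / n^(p-1) by tau^(p-1) leaves C / M. *)
  have := le_trans (fourier_tail_ge f p n (n + i)) tn; rewrite lee_fin => hS.
  rewrite (le_trans _ CM) // -taun invfM mulrA [X in _ <= X]mulrAC.
  by rewrite ler_wpM2r // invr_ge0 powR_ge0.
have hnl := hN (n + l)%N (leq_trans Nn (leq_addr _ _)) x Kx.
have hn : normc (\sum_(j < n) (fourier_sum f j x - f x)) <= e * (n + l)%:R.
  by rewrite (le_trans (hN n Nn x Kx)) // ler_wpM2l ?(ltW e0) // ler_nat leq_addr.
have := delayed_mean (D := fun j => fourier_sum f j x - f x) hnl hn step.
have enl : e * (n + l)%:R <= eps / 8 * l%:R.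
  rewrite -eL -mulrA ler_wpM2l ?(ltW e0) // natrD mulrDl mul1r.
  by rewrite lerD2r mulrC.
move=> h; rewrite -(ltr_pM2r l0) (le_lt_trans h) //.
have : 0 < eps * l%:R by rewrite mulr_gt0.
lra.
Unshelve. all: by end_near. Qed.

Local Close Scope complex_scope.

Theorem theorem6p3 (R : realType) (f : R -> R[i]) (p : R)
  (f_L1 : L1_circle f)
  (p_gt1 : 1 < p)
  (tail_bigO : exists C : R, \forall n \near \oo,
     (fourier_tail f p n <= (C / n%:R `^ (p - 1))%:E)%E)
  (K : set R)
  (K_periodic : periodic_set K)
  (K_closed : closed K)
  (K_cont : K `<=` continuity_set f) :
  {uniform K, (fourier_sum f : nat -> R -> R[i]^o) @ \oo -->
              (f : R -> R[i]^o)}.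
Proof.
move=> P /uniform_nbhs[E [+ EP]]; rewrite -entourage_from_ballE => -[/= e e0 eE].
(* Balls in R[i] have complex radii; a positive one is real. *)
have e_real : e = (Re e)%:C%C by rewrite RRe_real // gtr0_real.
have Re_gt0 : 0 < Re e by rewrite e_real ltcR in e0.
have := fourier_sum_uniform f_L1 p_gt1 tail_bigO
  K_periodic K_closed K_cont Re_gt0.
apply: filterS => n hn; apply: EP => x Kx; apply: eE => /=.
rewrite /ball /= distrC e_real /Num.norm /= ltcR.
exact: hn.
Qed.
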